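(* Let $G$ be an $(r,s)$-directed hypergraph and let $p,q\ge1$ be real numbers with $r/p+s/q<1$. Define, for $x>r/p+s/q$, $$f_G(x)=\Big(\big(\tfrac{r}{\Delta^+}\big)^{r/(px)}\big(\tfrac{s}{\Delta^-}\big)^{s/(qx)}\lambda_{px,qx}(G)\Big)^{\frac{1}{1-(r/(px)+s/(qx))}},$$ $$g_G(x)=\Big(\big(\tfrac{r}{\delta^+}\big)^{r/(px)}\big(\tfrac{s}{\delta^-}\big)^{s/(qx)}\lambda_{px,qx}(G)\Big)^{\frac{1}{1-(r/(px)+s/(qx))}}.$$ Then $f_G$ is non-decreasing on $(r/p+s/q,\infty)$ and $g_G$ is non-increasing on $(r/p+s/q,\infty)$.
   Context: Let $r,s$ be positive integers. An $(r,s)$-directed hypergraph $G$ consists of a finite vertex set $V(G)$ and a finite set $E(G)$ of arcs. Each arc $e$ is an ordered pair $(T(e),H(e))$ of disjoint subsets of $V(G)$ (tail and head) with $|T(e)|=r$ and $|H(e)|=s$. Write $T(G)=\bigcup_eT(e)$ and $H(G)=\bigcup_eH(e)$. For real vectors $\mathbf{x}=(x_u)_{u\in T(G)}$ and $\mathbf{y}=(y_v)_{v\in H(G)}$, indexed independently, set $P_G(\mathbf x,\mathbf y)=\sum_{e\in E(G)}\prod_{u\in T(e)}x_u\prod_{v\in H(e)}y_v$. For real $p,q\ge1$ let $\lambda_{p,q}(G)=\max\{P_G(\mathbf x,\mathbf y):\|\mathbf x\|_p=\|\mathbf y\|_q=1\}$. Degrees: the out-degree $d_v^+$ is the number of arcs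 $e$ with $v\in T(e)$, and the in-degree $d_v^-$ is the number of arcs with $v\in H(e)$. Set $\Delta^+=\max_{v\in T(G)}d_v^+$, $\delta^+=\min_{v\in T(G)}d_v^+$, $\Delta^-=\max_{v\in H(G)}d_v^-$ and $\delta^-=\min_{v\in H(G)}d_v^-$. *)

(* Defs.v *)
From mathcomp Require Import all_boot all_order all_algebra.
From mathcomp Require Import all_classical all_reals all_analysis.

Set Implicit Arguments.
Unset Strict Implicit.
Unset Printing Implicit Defensive.

Import Order.TTheory GRing.Theory Num.Theory.
Import numFieldNormedType.Exports.

Local Open Scope ring_scope.

Record dihypergraph (V : finType) (r s : nat) := DiHypergraph {
  arcs : {set {set V} * {set V}};
  arcsP : forall e, e \in arcs ->
    [/\ #|e.1| = r, #|e.2| = s & [disjoint e.1 & e.2]]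
}.

Section DiHypergraph.
Context (R : realType) (V : finType) (r s : nat) (G : dihypergraph V r s).

Definition tails : {set V} := \bigcup_(e in arcs G) e.1.
Definition heads : {set V} := \bigcup_(e in arcs G) e.2.

Definition outdeg (v : V) : nat := #|[pred e in arcs G | v \in e.1]|.
Definition indeg (v : V) : nat := #|[pred e in arcs G | v \in e.2]|.

Definition max_outdeg : nat := \max_(v in tails) outdeg v.
Definition max_indeg : nat := \max_(v in heads) indeg v.

(* Every degree is at most the number of arcs, so this neutral element does
   not affect the minimum. *)
Definition min_outdeg : nat := \big[minn/#|arcs G|]_(v in tails) outdeg v.
Definition min_indeg : nat := \big[minn/#|arcs G|]_(v in heads) indeg v.

(* [x] and [y] are indexed by the subtypes of V carried by T(G) and H(G);
   as e.1 \subset tails and e.2 \subset heads for an arc e, the products run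
   over all of e.1 and all of e.2. *)
Definition polyform (x : {u : V | u \in tails} -> R)
    (y : {v : V | v \in heads} -> R) : R :=
  \sum_(e in arcs G)
    (\prod_(u | val u \in e.1) x u) * (\prod_(v | val v \in e.2) y v).

End DiHypergraph.

Arguments polyform {R V r s} G x y.

Definition lpnorm (R : realType) (I : finType) (p : R) (x : I -> R) : R :=
  (\sum_i `|x i| `^ p) `^ p^-1.

Definition lambda_values (R : realType) (V : finType) (r s : nat)
    (G : dihypergraph V r s) (p q : R) : set R :=
  [set z | exists x y,
     [/\ lpnorm p x = 1, lpnorm q y = 1 & z = polyform G x y]]%classic.

(* This supremum is a maximum when p, q >= 1 and G has an arc, see [lambda_max]
   below. Without arcs there is no unit vector, and lambda, fG and gG are 0. *)
Definition lambda (R : realType) (V : finType) (r s : nat)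
    (G : dihypergraph V r s) (p q : R) : R := sup (lambda_values G p q).

Definition fG (R : realType) (V : finType) (r s : nat)
    (G : dihypergraph V r s) (p q x : R) : R :=
  ((r%:R / (max_outdeg G)%:R) `^ (r%:R / (p * x))
   * (s%:R / (max_indeg G)%:R) `^ (s%:R / (q * x))
   * lambda G (p * x) (q * x))
  `^ (1 / (1 - (r%:R / (p * x) + s%:R / (q * x)))).

Definition gG (R : realType) (V : finType) (r s : nat)
    (G : dihypergraph V r s) (p q x : R) : R :=
  ((r%:R / (min_outdeg G)%:R) `^ (r%:R / (p * x))
   * (s%:R / (min_indeg G)%:R) `^ (s%:R / (q * x))
   * lambda G (p * x) (q * x))
  `^ (1 / (1 - (r%:R / (p * x) + s%:R / (q * x)))).

Section LambdaMax.
Context (R : realType).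
Local Open Scope classical_set_scope.

Lemma continuous_prodF (T : topologicalType) (I : Type) (l : seq I)
    (P : pred I) (F : I -> T -> R) :
  (forall i, P i -> continuous (F i)) ->
  continuous (fun t => \prod_(i <- l | P i) F i t).
Proof.
move=> cF t; rewrite /continuous_at; elim: l => [|i l IH].
  rewrite big_nil; under eq_fun do rewrite big_nil; exact: cvg_cst.
rewrite big_cons; under eq_fun do rewrite big_cons.
by case: ifPn => // Pi; apply: cvgM => //; exact: cF.
Qed.

Lemma continuous_sumF (T : topologicalType) (I : Type) (l : seq I)
    (P : pred I) (F : I -> T -> R) :
  (forall i, P i -> continuous (F i)) ->
  continuous (fun t => \sum_(i <- l | P i) F i t).
Proof.
move=> cF t; rewrite /continuous_at; elim: l => [|i l IH].
  rewrite big_nil; under eq_fun do rewrite big_nil; exact: cvg_cst.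
rewrite big_cons; under eq_fun do rewrite big_cons.
by case: ifPn => // Pi; apply: cvgD => //; exact: cF.
Qed.

Lemma continuous_abs_powR (p : R) : 0 < p ->
  continuous (fun a : R => `|a| `^ p).
Proof.
move=> p0 a; have [->|a0] := eqVneq a 0.
  rewrite /continuous_at normr0 powR0 ?gt_eqF//.
  apply/cvgrPdist_lt => e e0.
  have near0 : \forall b \near (0 : R), `|b| < e `^ p^-1.
    apply: (@pseudometric_normed_Zmodule.nbhs0_lt R R); exact: powR_gt0.
  near=> b.
  rewrite sub0r normrN ger0_norm ?powR_ge0//.
  have -> : e = (e `^ p^-1) `^ p.
    by rewrite -powRrM mulVf ?gt_eqF// powRr1// ltW.
  rewrite gt0_ltr_powR ?nnegrE ?powR_ge0//.
  by near: b; exact: near0.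
have ca : {for `|a|, continuous (fun b : R => b `^ p)}.
  apply: differentiable_continuous; apply/derivable1_diffP.
  by apply: derivable_powR; rewrite in_itv/= andbT normr_gt0.
apply: (@continuous_comp _ _ _ (fun b : R => `|b|) (fun b => b `^ p)) => //.
exact: norm_continuous.
Unshelve. all: by end_near. Qed.

Lemma lpnorm_eq1 (I : finType) (p : R) (x : I -> R) : 0 < p ->
  lpnorm p x = 1 <-> \sum_i `|x i| `^ p = 1.
Proof.
move=> p0; rewrite /lpnorm; split=> [h|->]; last by rewrite powR1.
have S0 : 0 <= \sum_i `|x i| `^ p by apply: sumr_ge0 => i _; exact: powR_ge0.
by rewrite -[LHS]powRr1// -[X in _ `^ X](@mulVf _ p) ?gt_eqF// powRrM h powR1.
Qed.

Lemma compact_lpsphere (I : finType) (p : R) : 0 < p ->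
  compact ([set x | lpnorm p x = 1] : set (prod_topology (fun _ : I => R))).
Proof.
move=> p0.
pose A : set (prod_topology (fun _ : I => R)) :=
  [set x | forall i, `[(-1 : R), (1 : R)]%classic (x i)].
have cA : compact A.
  exact: (@tychonoff I (fun=> R) (fun=> `[(-1 : R), (1 : R)]%classic)
    (fun=> @segment_compact R (-1) 1)).
apply: (subclosed_compact _ cA).
  rewrite (_ : mkset _ =
    (fun x : prod_topology (fun _ : I => R) => \sum_i `|x i| `^ p) @^-1`
      [set 1]); last first.
    by apply/seteqP; split => x /= /lpnorm_eq1; apply.
  apply: preimage_closed; last exact: closed_eq.
  move=> x _; apply: continuous_sumF => i _.
  move=> {}x; apply: (@continuous_comp _ _ _
    (fun x : prod_topology (fun _ : I => R) => x i) (fun b => `|b| `^ p)).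
    exact: proj_continuous.
  exact: continuous_abs_powR.
move=> x /= /(lpnorm_eq1 _ p0) x1 i; rewrite /= in_itv/= -ler_norml.
rewrite leNgt; apply/negP => xi1.
have : 1 < `|x i| `^ p.
  by rewrite -[ltLHS](congr1 (@^~ p) (powR1 R)) gt0_ltr_powR ?nnegrE.
rewrite -x1 (bigD1 i)//= gtrDl ltNge sumr_ge0// => j _; exact: powR_ge0.
Qed.

Lemma lpsphere_neq0 (I : finType) (p : R) (i0 : I) : 0 < p ->
  exists x : I -> R, lpnorm p x = 1.
Proof.
move=> p0; exists (fun i => (i == i0)%:R); apply/lpnorm_eq1 => //.
rewrite (bigD1 i0)//= eqxx normr1 powR1 big1 ?addr0// => i /negPf ->.
by rewrite normr0 powR0 ?gt_eqF.
Qed.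

Lemma lambda_max (V : finType) (r s : nat) (G : dihypergraph V r s)
    (p q : R) : (0 < r)%N -> (0 < s)%N -> 1 <= p -> 1 <= q ->
  arcs G != finset.set0 ->
  lambda_values G p q (lambda G p q) /\
  ubound (lambda_values G p q) (lambda G p q).
Proof.
move=> r0 s0 p1 q1 /set0Pn[e eG].
have p0 : 0 < p := lt_le_trans ltr01 p1.
have q0 : 0 < q := lt_le_trans ltr01 q1.
have [er es _] := arcsP eG.
have /card_gt0P[u ue] : (0 < #|e.1|)%N by rewrite er.
have /card_gt0P[v ve] : (0 < #|e.2|)%N by rewrite es.
have uT : u \in tails G by apply/bigcupP; exists e.
have vH : v \in heads G by apply/bigcupP; exists e.
pose TX := prod_topology (fun _ : {u : V | u \in tails G} => R).
pose TY := prod_topology (fun _ : {v : V | v \in heads G} => R).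
pose A : set (TX * TY) :=
  [set x : TX | lpnorm p x = 1] `*` [set y : TY | lpnorm q y = 1].
have A0 : A !=set0.
  have [x x1] := lpsphere_neq0 (exist _ u uT) p0.
  have [y y1] := lpsphere_neq0 (exist _ v vH) q0.
  by exists (x, y).
have cA : compact A by apply: compact_setX; exact: compact_lpsphere.
pose f (z : TX * TY) : R := polyform G (z.1 : _ -> R) (z.2 : _ -> R).
have cf : continuous f.
  have cX u' : continuous (fun z : TX * TY => z.1 u').
    move=> t; apply: (@continuous_comp _ _ _ fst (fun x : TX => x u')).
      exact: cvg_fst.
    exact: proj_continuous.
  have cY v' : continuous (fun z : TX * TY => z.2 v').
    move=> t; apply: (@continuous_comp _ _ _ snd (fun y : TY => y v')).
      exact: cvg_snd.
    exact: proj_continuous.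
  apply: (@continuous_sumF (TX * TY)%type _ _ _
    (fun (a : {set V} * {set V}) (z : TX * TY) =>
    (\prod_(u | val u \in a.1) z.1 u) * (\prod_(v | val v \in a.2) z.2 v))).
  move=> a _ z.
  apply: (@cvgM _ (TX * TY)%type (nbhs z) _
    (fun z : TX * TY => \prod_(u | val u \in a.1) z.1 u)
    (fun z : TX * TY => \prod_(v | val v \in a.2) z.2 v)).
    exact: (@continuous_prodF (TX * TY)%type _ _ _
      (fun u (z : TX * TY) => z.1 u) (fun u _ => cX u)).
  exact: (@continuous_prodF (TX * TY)%type _ _ _
    (fun v (z : TX * TY) => z.2 v) (fun v _ => cY v)).
have [[x y] /set_mem[/= x1 y1] fmax] :=
  compact_EVT_max A0 cA (continuous_subspaceT cf).
have ub : ubound (lambda_values G p q) (polyform G x y).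
  by move=> _ [x' [y' [x'1 y'1 ->]]]; apply: (fmax (x', y')); exact/mem_set.
have val : lambda_values G p q (polyform G x y) by exists x, y.
suff -> : lambda G p q = polyform G x y by [].
apply/eqP; rewrite eq_le; apply/andP; split.
  by apply: ge_sup => //; exists (polyform G x y).
by apply: ub_le_sup => //; exists (polyform G x y).
Qed.

End LambdaMax.

(* Main.v *)
(* Substituting a_u = x_u^p and b_v = y_v^q turns lambda_{p,q} into the maximum,
   over probability vectors a and b, of sum_e A_e^(r/p) B_e^(s/q), where A_e and
   B_e are the geometric means of a over T(e) and of b over H(e). Passing from x
   to x' > x multiplies the exponents alpha = r/(px), beta = s/(qx) by
   t = x/x' < 1.

   For f: by AM-GM and double counting, the sums over e of (r/Delta+) A_e and of
   (s/Delta-) B_e are at most 1; hence, with gamma = alpha + beta, so is the sum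
   of their weighted geometric means C_e, with weights alpha/gamma and
   beta/gamma. The claim is then the log-convexity of u |-> sum_e C_e^u at the
   points t gamma < gamma < 1.

   For g: let F(x) be the base of the outer power in g(x). Hoelder's inequality
   against the constant 1 gives F(x') <= |E|^(1-t) F(x)^t, and choosing a and b
   proportional to the degrees gives |E|^(1-gamma) <= F(x). *)
Require Import Defs.
From mathcomp Require Import all_boot all_order all_algebra.
From mathcomp Require Import all_classical all_reals all_analysis.
From mathcomp Require Import ring lra.

Set Implicit Arguments.
Unset Strict Implicit.
Unset Printing Implicit Defensive.

Import Order.TTheory GRing.Theory Num.Theory.
Local Open Scope ring_scope.

(** * Hoelder-type inequalities for finite sums of real powers *)

Section PowerSums.
Context (R : realType).

Lemma powR_prod (I : Type) (l : seq I) (P : pred I) (F : I -> R) (x : R) :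
  (forall i, P i -> 0 <= F i) ->
  (\prod_(i <- l | P i) F i) `^ x = \prod_(i <- l | P i) F i `^ x.
Proof.
move=> F0; elim: l => [|i l IH]; first by rewrite !big_nil powR1.
by rewrite !big_cons; case: ifPn => // Pi; rewrite powRM ?IH ?F0 ?prodr_ge0.
Qed.

(** Weighted AM-GM, as Young's inequality with conjugate exponents 1/(1-t) and 1/t. *)
Lemma young_powR (a b t : R) : 0 <= a -> 0 <= b -> 0 < t < 1 ->
  a `^ (1 - t) * b `^ t <= (1 - t) * a + t * b.
Proof.
move=> a0 b0 /andP[t0 t1]; have t1' : 0 < 1 - t by rewrite subr_gt0.
apply: (le_trans (@conjugate_powR _ _ _ (1 - t)^-1 t^-1 _ _ _ _ _));
  rewrite ?powR_ge0 ?invr_gt0 ?invrK ?subrK//.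
by rewrite -!powRrM !mulfV ?gt_eqF// !powRr1// !(mulrC _ (1 - t)) (mulrC _ t).
Qed.

(** Dividing each family by its sum reduces the claim to [young_powR] term by term. If one of the
    sums vanishes, so does every term on the left. *)
Lemma hoelder_sum (I : finType) (D : pred I) (a b : I -> R) (t : R) :
  (forall i, 0 <= a i) -> (forall i, 0 <= b i) -> 0 < t < 1 ->
  \sum_(i | D i) a i `^ (1 - t) * b i `^ t <=
  (\sum_(i | D i) a i) `^ (1 - t) * (\sum_(i | D i) b i) `^ t.
Proof.
move=> a0 b0 /[dup] t01 /andP[t0 t1].
have t1' : 0 < 1 - t by rewrite subr_gt0.
set A := \sum_(i | D i) a i; set B := \sum_(i | D i) b i.
have A0 : 0 <= A by exact: sumr_ge0.
have B0 : 0 <= B by exact: sumr_ge0.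
have [A_eq0|A_neq0] := eqVneq A 0.
  rewrite big1 ?mulr_ge0 ?powR_ge0// => i Di.
  have/eqP := A_eq0; rewrite psumr_eq0// => /allP/(_ i).
  rewrite mem_index_enum Di => /(_ isT) /eqP ->.
  by rewrite powR0 ?gt_eqF// mul0r.
have [B_eq0|B_neq0] := eqVneq B 0.
  rewrite big1 ?mulr_ge0 ?powR_ge0// => i Di.
  have/eqP := B_eq0; rewrite psumr_eq0// => /allP/(_ i).
  rewrite mem_index_enum Di => /(_ isT) /eqP ->.
  by rewrite powR0 ?gt_eqF// mulr0.
apply: (@le_trans _ _ (\sum_(i | D i) A `^ (1 - t) * B `^ t *
    ((1 - t) * (a i / A) + t * (b i / B)))).
  apply: ler_sum => i _.
  rewrite -{1}(divfK A_neq0 (a i)) -{1}(divfK B_neq0 (b i)).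
  rewrite (powRM (1 - t) _ A0) ?divr_ge0// (powRM t _ B0) ?divr_ge0//.
  rewrite mulrACA [leLHS]mulrC.
  by rewrite ler_wpM2l ?mulr_ge0 ?powR_ge0// young_powR ?divr_ge0.
rewrite -mulr_sumr big_split/= -!mulr_sumr -!mulr_suml.
by rewrite !mulfV// !mulr1 subrK mulr1.
Qed.

(** Log-convexity of u |-> sum of c_i^u between the points g' and 1: Hoelder leaves the sum at
    exponent 1 as a second factor, which is at most 1. *)
Lemma power_sum_le (I : finType) (D : pred I) (c : I -> R) (g g' : R) :
  (forall i, 0 <= c i) -> \sum_(i | D i) c i <= 1 -> 0 < g' -> g' < g -> g < 1 ->
  \sum_(i | D i) c i `^ g <=
  (\sum_(i | D i) c i `^ g') `^ ((1 - g) / (1 - g')).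
Proof.
move=> c0 c1 g'0 g'g g1; have g1' : 0 < 1 - g' by lra.
(* The weight for which g = (1 - t) g' + t. *)
pose t := (g - g') / (1 - g').
have t01 : 0 < t < 1 by rewrite divr_gt0 ?ltr_pdivrMr//=; lra.
have -> : (1 - g) / (1 - g') = 1 - t by rewrite /t; field; rewrite gt_eqF.
have tg : g' * (1 - t) + t = g by rewrite /t; field; rewrite gt_eqF.
have cE i : c i `^ g = (c i `^ g') `^ (1 - t) * c i `^ t.
  rewrite -powRrM -powRD tg//; apply/implyP => /eqP g_eq0; lra.
rewrite (eq_bigr _ (fun i _ => cE i)).
apply: (le_trans (hoelder_sum _ _ _ t01)) => //.
  by move=> i; exact: powR_ge0.
rewrite ler_piMr ?powR_ge0// -[leRHS](congr1 (@^~ t) (powR1 R)).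
by rewrite ge0_ler_powR ?nnegrE ?sumr_ge0//; case/andP: t01 => /ltW.
Qed.

(** The weighted geometric means c_i of a_i and b_i have total at most 1 by [young_powR], so
    [power_sum_le] applies to them. *)
Lemma mixed_power_sum_le (I : finType) (D : pred I) (a b : I -> R)
    (alpha beta t : R) :
  (forall i, 0 <= a i) -> (forall i, 0 <= b i) ->
  \sum_(i | D i) a i <= 1 -> \sum_(i | D i) b i <= 1 ->
  0 < alpha -> 0 < beta -> alpha + beta < 1 -> 0 < t -> t < 1 ->
  \sum_(i | D i) a i `^ alpha * b i `^ beta <=
  (\sum_(i | D i) a i `^ (t * alpha) * b i `^ (t * beta))
    `^ ((1 - (alpha + beta)) / (1 - t * (alpha + beta))).
Proof.
move=> a0 b0 a1 b1 al0 be0; set g := alpha + beta => g1 t0 t1.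
have g0 : 0 < g by exact: addr_gt0.
set u := beta / g; have ug : u * g = beta by rewrite divfK ?gt_eqF.
have u01 : 0 < u < 1 by rewrite divr_gt0 ?ltr_pdivrMr//= mul1r ltrDr.
pose c i := a i `^ (1 - u) * b i `^ u.
have c0 i : 0 <= c i by rewrite mulr_ge0 ?powR_ge0.
have c1 : \sum_(i | D i) c i <= 1.
  apply: (@le_trans _ _ (\sum_(i | D i) ((1 - u) * a i + u * b i))).
    by apply: ler_sum => i _; exact: young_powR.
  rewrite big_split/= -!mulr_sumr -[leRHS](subrK u).
  case/andP: u01 => u0 u1.
  by apply: lerD; apply: ler_piMr; rewrite ?subr_ge0// ltW.
(* The weights 1 - u = alpha/g and u = beta/g are chosen so that one power of c_i yields both
   factors; this is used at x = 1 and at x = t. *)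
have cE x i : c i `^ (x * g) = a i `^ (x * alpha) * b i `^ (x * beta).
  rewrite powRM ?powR_ge0// -!powRrM mulrCA mulrBl mul1r ug.
  by rewrite [u * _]mulrCA ug /g addrK.
have cE1 i : c i `^ g = a i `^ alpha * b i `^ beta.
  by have := cE 1 i; rewrite !mul1r.
rewrite -(eq_bigr _ (fun i _ => cE1 i)) -(eq_bigr _ (fun i _ => cE t i)).
by apply: power_sum_le => //; rewrite ?mulr_gt0// gtr_pMl.
Qed.

(** Hoelder against the constant family 1, whose sum over D is #|D|. *)
Lemma mixed_power_sum_le_card (I : finType) (D : {set I}) (a b : I -> R)
    (alpha beta t : R) : 0 < t < 1 ->
  \sum_(i in D) a i `^ (t * alpha) * b i `^ (t * beta) <=
  #|D|%:R `^ (1 - t) * (\sum_(i in D) a i `^ alpha * b i `^ beta) `^ t.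
Proof.
move=> t01; have -> : #|D|%:R = \sum_(i in D) 1 :> R by rewrite sumr_const.
apply: (le_trans _ (hoelder_sum _ (fun=> ler01) _ t01)) => [|i]; last first.
  by rewrite mulr_ge0 ?powR_ge0.
apply: ler_sum => i _; rewrite powR1 mul1r powRM ?powR_ge0// -!powRrM.
by rewrite !(mulrC t).
Qed.

End PowerSums.

(** * Geometric means over a uniform family of sets, treating tails and heads at once *)

(** The root is taken with the full cardinality of S while the product sees only elements of A, so
    this is a geometric mean when S is contained in A. *)
Definition gmean (R : realType) (V : finType) (A : {set V})
    (a : {v : V | v \in A} -> R) (S : {set V}) : R :=
  (\prod_(u | val u \in S) a u) `^ (#|S|%:R)^-1.

Definition prob_vector (R : realType) (I : finType) (a : I -> R) : Prop :=
  (forall i, 0 <= a i) /\ \sum_i a i = 1.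

Section SetFamily.
Context (R : realType) (V I : finType) (A : {set V}) (D : {set I}).
Context (S : I -> {set V}) (k : nat).
Hypothesis k_gt0 : (0 < k)%N.
Hypothesis card_S : forall i, i \in D -> #|S i| = k.
Hypothesis sub_S : forall i, i \in D -> S i \subset A.

Let degree (v : V) : nat := #|[pred i in D | v \in S i]|.

Lemma gmean_ge0 (a : {v : V | v \in A} -> R) (T : {set V}) : 0 <= gmean a T.
Proof. exact: powR_ge0. Qed.

Lemma card_sub_mem (T : {set V}) : T \subset A ->
  #|[pred u : {v : V | v \in A} | val u \in T]| = #|T|.
Proof.
move=> TA; rewrite -(fintype.card_image val_inj); apply: eq_card => v.
apply/fintype.imageP/idP => [[u uT ->]//|vT].
by exists (exist _ v (fintype.subsetP TA v vT)).
Qed.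

(** With x = 1/P this rewrites one monomial of [polyform], after the substitution, as a power of a
    geometric mean. *)
Lemma gmean_powR (a : {v : V | v \in A} -> R) (x : R) i :
  (forall u, 0 <= a u) -> i \in D ->
  \prod_(u | val u \in S i) a u `^ x = gmean a (S i) `^ (k%:R * x).
Proof.
move=> a0 iD; rewrite -powR_prod// /gmean card_S// -powRrM mulrA mulVf ?mul1r//.
by rewrite pnatr_eq0 -lt0n.
Qed.

Lemma gmean_le_mean (a : {v : V | v \in A} -> R) i :
  (forall u, 0 <= a u) -> i \in D ->
  gmean a (S i) <= (\sum_(u | val u \in S i) a u) / k%:R.
Proof.
move=> a0 iD; rewrite /gmean card_S//.
have k0 : (k%:R : R) != 0 by rewrite pnatr_eq0 -lt0n.
set m := _ / _; have m0 : 0 <= m by rewrite divr_ge0// sumr_ge0.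
rewrite -[leRHS](_ : (m `^ k%:R) `^ k%:R^-1 = m); last first.
  by rewrite -powRrM mulfV// powRr1.
rewrite ge0_ler_powR ?invr_ge0//.
- by rewrite nnegrE prodr_ge0.
- by rewrite nnegrE powR_ge0.
rewrite powR_mulrn//.
have := @leif_AGM R _ [pred u : {v : V | v \in A} | val u \in S i] a
  (fun u _ => a0 u).
by rewrite card_sub_mem ?sub_S// card_S// => -[].
Qed.

Lemma gmean_ge (a : {v : V | v \in A} -> R) (m : R) i :
  0 <= m -> (forall u, m <= a u) -> i \in D -> m <= gmean a (S i).
Proof.
move=> m0 am iD; rewrite /gmean card_S//.
have k0 : (k%:R : R) != 0 by rewrite pnatr_eq0 -lt0n.
have a0 u : 0 <= a u := le_trans m0 (am u).
rewrite -[leLHS](_ : (m `^ k%:R) `^ k%:R^-1 = m); last first.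
  by rewrite -powRrM mulfV// powRr1.
rewrite ge0_ler_powR ?invr_ge0//.
- by rewrite nnegrE powR_ge0.
- by rewrite nnegrE prodr_ge0.
rewrite powR_mulrn// -(card_S iD) -(card_sub_mem (sub_S iD)) -prodr_const.
by apply: ler_prod => u _; rewrite m0 am.
Qed.

(** Double counting of the pairs (i, u) with u in [S i]. *)
Lemma sum_incident (a : {v : V | v \in A} -> R) :
  \sum_(i in D) \sum_(u | val u \in S i) a u =
  \sum_u (degree (val u))%:R * a u.
Proof.
rewrite (exchange_big_dep xpredT)//=; apply: eq_bigr => u _.
by rewrite sumr_const mulr_natl.
Qed.

(** AM-GM on each set replaces the geometric means by averages; in the double count each a_u then
    appears at most M times, and the a_u sum to 1. *)
Lemma sum_gmean_le (a : {v : V | v \in A} -> R) (M : nat) :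
  prob_vector a -> (forall v, v \in A -> (degree v <= M)%N) ->
  k%:R / M%:R * \sum_(i in D) gmean a (S i) <= 1.
Proof.
move=> [a0 a1] dM.
have k0 : 0 < (k%:R : R) by rewrite ltr0n.
(* Division by zero gives 0, so the bound is trivial for M = 0. *)
have [->|M0] := posnP M; first by rewrite invr0 mulr0 mul0r.
have {}M0 : 0 < (M%:R : R) by rewrite ltr0n.
rewrite mulrAC ler_pdivrMr// mul1r mulrC -ler_pdivlMr//.
apply: (@le_trans _ _ (\sum_(i in D) (\sum_(u | val u \in S i) a u) / k%:R)).
  by apply: ler_sum => i iD; exact: gmean_le_mean.
rewrite -mulr_suml sum_incident ler_pM2r ?invr_gt0//.
rewrite -[leRHS](_ : \sum_u M%:R * a u = _); last by rewrite -mulr_sumr a1 mulr1.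
apply: ler_sum => u _; rewrite ler_wpM2r// ler_nat dM//; exact: (valP u).
Qed.

(** Weights proportional to the degrees: each is at least m / (k #|D|), hence so is every geometric
    mean of them. *)
Lemma gmean_degree_vector (m : nat) : D != finset.set0 -> (0 < m)%N ->
  (forall v, v \in A -> (m <= degree v)%N) ->
  exists2 a : {v : V | v \in A} -> R, prob_vector a &
    forall i, i \in D -> (#|D|%:R)^-1 <= k%:R / m%:R * gmean a (S i).
Proof.
rewrite -card_gt0 => D0 m0 md.
have n0 : 0 < (k%:R * #|D|%:R : R) by rewrite mulr_gt0 ?ltr0n.
(* The normalising constant k #|D| is the sum of all degrees, since each of the #|D| sets has k
   elements. *)
exists (fun u => (degree (val u))%:R / (k%:R * #|D|%:R)).
  split=> [u|]; first by rewrite divr_ge0// ltW.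
  rewrite -mulr_suml; apply: (canLR (mulfK _)); rewrite ?gt_eqF// mul1r.
  transitivity (\sum_u (degree (val (u : {v : V | v \in A})))%:R * (1 : R)).
    by apply: eq_bigr => u _; rewrite mulr1.
  rewrite -sum_incident mulrC mulr_natl -sumr_const; apply: eq_bigr => i iD.
  by rewrite sumr_const card_sub_mem ?sub_S// card_S.
move=> i iD; have k0 : 0 < (k%:R : R) by rewrite ltr0n.
have {}m0 : 0 < (m%:R : R) by rewrite ltr0n.
rewrite -ler_pdivrMl ?divr_gt0//.
have -> : (k%:R / m%:R)^-1 / #|D|%:R = m%:R / (k%:R * #|D|%:R) :> R.
  by field; rewrite !gt_eqF// ltr0n.
apply: gmean_ge => // u.
by rewrite ler_pM2r ?invr_gt0// ler_nat md//; exact: (valP u).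
Qed.

End SetFamily.

(** * Elementary facts on arcs and minimum degrees *)

Section Degrees.
Context (V : finType) (r s : nat) (G : dihypergraph V r s).

Lemma tail_sub e : e \in arcs G -> e.1 \subset tails G.
Proof. by move=> eG; exact: (finset.bigcup_sup e). Qed.

Lemma head_sub e : e \in arcs G -> e.2 \subset heads G.
Proof. by move=> eG; exact: (finset.bigcup_sup e). Qed.

Lemma card_tail e : e \in arcs G -> #|e.1| = r.
Proof. by case/arcsP. Qed.

Lemma card_head e : e \in arcs G -> #|e.2| = s.
Proof. by case/arcsP. Qed.

Lemma min_outdeg_le v : v \in tails G -> (min_outdeg G <= outdeg G v)%N.
Proof. by move=> vT; rewrite /min_outdeg -minEnat -leEnat; exact: bigmin_le_cond. Qed.

Lemma min_indeg_le v : v \in heads G -> (min_indeg G <= indeg G v)%N.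
Proof. by move=> vH; rewrite /min_indeg -minEnat -leEnat; exact: bigmin_le_cond. Qed.

Lemma min_outdeg_gt0 : arcs G != finset.set0 -> (0 < min_outdeg G)%N.
Proof.
rewrite -card_gt0 => G0; rewrite /min_outdeg.
(* The neutral element #|arcs G| of the minimum is itself positive, and each vertex of T(G) lies in
   the tail of some arc. *)
apply: (big_ind (fun n => 0 < n)%N) => // [m n m0 n0|v /bigcupP[e eG ve]].
  by rewrite leq_min m0.
by apply/card_gt0P; exists e; rewrite inE eG.
Qed.

Lemma min_indeg_gt0 : arcs G != finset.set0 -> (0 < min_indeg G)%N.
Proof.
rewrite -card_gt0 => G0; rewrite /min_indeg.
apply: (big_ind (fun n => 0 < n)%N) => // [m n m0 n0|v /bigcupP[e eG ve]].
  by rewrite leq_min m0.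
by apply/card_gt0P; exists e; rewrite inE eG.
Qed.

End Degrees.

(** * Expressing [lambda] through probability vectors *)

Section LambdaProb.
Context (R : realType) (V : finType) (r s : nat) (G : dihypergraph V r s).
Hypothesis (r_gt0 : (0 < r)%N) (s_gt0 : (0 < s)%N).
Hypothesis G_neq0 : arcs G != finset.set0.
Variables P Q : R.
Hypothesis (P_ge1 : 1 <= P) (Q_ge1 : 1 <= Q).

Let P_gt0 : 0 < P. Proof. exact: lt_le_trans ltr01 P_ge1. Qed.
Let Q_gt0 : 0 < Q. Proof. exact: lt_le_trans ltr01 Q_ge1. Qed.

Lemma polyform_powR (a : {u : V | u \in tails G} -> R)
    (b : {v : V | v \in heads G} -> R) :
  (forall u, 0 <= a u) -> (forall v, 0 <= b v) ->
  polyform G (fun u => a u `^ P^-1) (fun v => b v `^ Q^-1) =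
  \sum_(e in arcs G) gmean a e.1 `^ (r%:R / P) * gmean b e.2 `^ (s%:R / Q).
Proof.
move=> a0 b0; apply: eq_bigr => e eG; congr (_ * _).
  exact: (gmean_powR r_gt0 (@card_tail _ _ _ G) _ a0 eG).
exact: (gmean_powR s_gt0 (@card_head _ _ _ G) _ b0 eG).
Qed.

Lemma lpnorm_powR (I : finType) (t : R) (a : I -> R) : 0 < t ->
  prob_vector a -> lpnorm t (fun i => a i `^ t^-1) = 1.
Proof.
move=> t0 [a0 a1]; apply/lpnorm_eq1 => //; rewrite -[RHS]a1.
apply: eq_bigr => i _.
by rewrite ger0_norm ?powR_ge0// -powRrM mulVf ?gt_eqF// powRr1.
Qed.

Lemma gmean_sum_le_lambda (a : {u : V | u \in tails G} -> R)
    (b : {v : V | v \in heads G} -> R) : prob_vector a -> prob_vector b ->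
  \sum_(e in arcs G) gmean a e.1 `^ (r%:R / P) * gmean b e.2 `^ (s%:R / Q)
  <= lambda G P Q.
Proof.
move=> pa pb; rewrite -polyform_powR; [|exact: pa.1|exact: pb.1].
have [_ ub] := lambda_max r_gt0 s_gt0 P_ge1 Q_ge1 G_neq0.
apply: ub; do 2 eexists; split; last reflexivity; exact: lpnorm_powR.
Qed.

(** A maximiser (x, y) gives a = |x|^P and b = |y|^Q. Passing to absolute values can only increase
    the form, and [gmean_sum_le_lambda] gives the reverse inequality. *)
Lemma lambda_gmean_sum :
  exists (a : {u : V | u \in tails G} -> R) (b : {v : V | v \in heads G} -> R),
  [/\ prob_vector a, prob_vector b & lambda G P Q =
  \sum_(e in arcs G) gmean a e.1 `^ (r%:R / P) * gmean b e.2 `^ (s%:R / Q)].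
Proof.
have [[x [y [x1 y1 xyE]]] _] := lambda_max r_gt0 s_gt0 P_ge1 Q_ge1 G_neq0.
have pa : prob_vector (fun u => `|x u| `^ P).
  by split; [move=> u; exact: powR_ge0|exact/lpnorm_eq1].
have pb : prob_vector (fun v => `|y v| `^ Q).
  by split; [move=> v; exact: powR_ge0|exact/lpnorm_eq1].
do 2 eexists; split; [exact: pa|exact: pb|].
apply: le_anti; rewrite gmean_sum_le_lambda// andbT.
rewrite -polyform_powR; [|exact: pa.1|exact: pb.1].
rewrite xyE; apply: ler_sum => e _.
apply: (le_trans (ler_norm _)); rewrite normrM !normr_prod.
by under [in leRHS]eq_bigr do rewrite -powRrM mulfV ?gt_eqF// powRr1//;
  under [X in _ <= _ * X]eq_bigr do rewrite -powRrM mulfV ?gt_eqF// powRr1//.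
Qed.

End LambdaProb.

(** * Monotonicity of the rescaled [lambda] *)

Section Monotonicity.
Context (R : realType) (V : finType) (r s : nat) (G : dihypergraph V r s).
Hypothesis (r_gt0 : (0 < r)%N) (s_gt0 : (0 < s)%N).
Hypothesis G_neq0 : arcs G != finset.set0.
Variables k l : R.
Hypothesis (k_ge0 : 0 <= k) (l_ge0 : 0 <= l).

(** The base of the outer power in [fG] or [gG], when k and l are r and s divided by the maximum or
    the minimum degrees. *)
Definition scaled_lambda (P Q : R) : R :=
  k `^ (r%:R / P) * l `^ (s%:R / Q) * lambda G P Q.

Lemma scaled_gmean_sum (alpha beta : R) (a : {u : V | u \in tails G} -> R)
    (b : {v : V | v \in heads G} -> R) :
  k `^ alpha * l `^ beta *
    \sum_(e in arcs G) gmean a e.1 `^ alpha * gmean b e.2 `^ beta =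
  \sum_(e in arcs G)
    (k * gmean a e.1) `^ alpha * (l * gmean b e.2) `^ beta.
Proof.
rewrite mulr_sumr; apply: eq_bigr => e _.
rewrite (powRM _ k_ge0 (gmean_ge0 _ _)) (powRM _ l_ge0 (gmean_ge0 _ _)).
by rewrite mulrACA.
Qed.

Lemma scaled_gmean_sum_le (P Q : R) (a : {u : V | u \in tails G} -> R)
    (b : {v : V | v \in heads G} -> R) : 1 <= P -> 1 <= Q ->
  prob_vector a -> prob_vector b ->
  \sum_(e in arcs G)
    (k * gmean a e.1) `^ (r%:R / P) * (l * gmean b e.2) `^ (s%:R / Q) <=
  scaled_lambda P Q.
Proof.
move=> P1 Q1 pa pb; rewrite -scaled_gmean_sum.
by rewrite ler_wpM2l ?mulr_ge0 ?powR_ge0// gmean_sum_le_lambda.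
Qed.

Lemma scaled_lambda_gmean (P Q : R) : 1 <= P -> 1 <= Q ->
  exists (a : {u : V | u \in tails G} -> R) (b : {v : V | v \in heads G} -> R),
  [/\ prob_vector a, prob_vector b & scaled_lambda P Q =
  \sum_(e in arcs G)
    (k * gmean a e.1) `^ (r%:R / P) * (l * gmean b e.2) `^ (s%:R / Q)].
Proof.
move=> P1 Q1; have [a [b [pa pb lE]]] := lambda_gmean_sum r_gt0 s_gt0 G_neq0 P1 Q1.
by exists a, b; split=> //; rewrite /scaled_lambda lE scaled_gmean_sum.
Qed.

Lemma scaled_lambda_ge0 (P Q : R) : 1 <= P -> 1 <= Q -> 0 <= scaled_lambda P Q.
Proof.
move=> P1 Q1; have [a [b [_ _ ->]]] := scaled_lambda_gmean P1 Q1.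
by apply: sumr_ge0 => e _; rewrite mulr_ge0 ?powR_ge0.
Qed.

(** * Comparison of two exponent pairs: (P', Q') belongs to the larger argument, and t is the ratio
    of the smaller argument to the larger *)

Variables P Q P' Q' alpha beta gamma t : R.
Hypothesis (P_ge1 : 1 <= P) (Q_ge1 : 1 <= Q).
Hypothesis (P'_ge1 : 1 <= P') (Q'_ge1 : 1 <= Q').
Hypothesis (t_gt0 : 0 < t) (t_lt1 : t < 1).
Hypothesis (alphaE : r%:R / P = alpha) (betaE : s%:R / Q = beta).
Hypothesis (P'E : r%:R / P' = t * alpha) (Q'E : s%:R / Q' = t * beta).
Hypothesis (gammaE : alpha + beta = gamma) (gamma_lt1 : gamma < 1).

Let alpha_gt0 : 0 < alpha.
Proof. by rewrite -alphaE divr_gt0 ?ltr0n// (lt_le_trans ltr01). Qed.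

Let beta_gt0 : 0 < beta.
Proof. by rewrite -betaE divr_gt0 ?ltr0n// (lt_le_trans ltr01). Qed.

Let gamma_gt0 : 0 < gamma. Proof. by rewrite -gammaE addr_gt0. Qed.

Let gamma' : r%:R / P' + s%:R / Q' = t * gamma.
Proof. by rewrite P'E Q'E -mulrDr gammaE. Qed.

Let tgamma_lt : t * gamma < gamma. Proof. by rewrite gtr_pMl. Qed.

(** At a maximiser for (P, Q), [mixed_power_sum_le] passes to the exponents t alpha and t beta,
    where the same vectors are admissible for (P', Q'). *)
Lemma scaled_lambda_homo :
  (forall a : {u : V | u \in tails G} -> R, prob_vector a ->
    k * \sum_(e in arcs G) gmean a e.1 <= 1) ->
  (forall b : {v : V | v \in heads G} -> R, prob_vector b ->
    l * \sum_(e in arcs G) gmean b e.2 <= 1) ->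
  scaled_lambda P Q `^ (1 / (1 - (r%:R / P + s%:R / Q))) <=
  scaled_lambda P' Q' `^ (1 / (1 - (r%:R / P' + s%:R / Q'))).
Proof.
move=> sum_a sum_b; rewrite gamma' alphaE betaE gammaE.
have g1 : 0 < 1 - gamma by rewrite subr_gt0.
have tg1 : 0 < 1 - t * gamma by rewrite subr_gt0 (lt_trans tgamma_lt).
(* Raising this to the power 1/(1 - gamma) gives the claim. *)
suff le_power : scaled_lambda P Q <=
    scaled_lambda P' Q' `^ ((1 - gamma) / (1 - t * gamma)).
  have -> : 1 / (1 - t * gamma) =
      (1 - gamma) / (1 - t * gamma) * (1 / (1 - gamma)).
    by field; rewrite !gt_eqF.
  rewrite [leRHS]powRrM ge0_ler_powR ?nnegrE ?powR_ge0 ?scaled_lambda_ge0//.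
  by rewrite divr_ge0 ?ler01// ltW.
have [a [b [pa pb lE]]] := scaled_lambda_gmean P_ge1 Q_ge1.
rewrite alphaE betaE in lE; rewrite lE -gammaE.
apply: le_trans (mixed_power_sum_le (t := t) _ _ _ _ _ _ _ _ _) _ => //.
- by move=> e; rewrite mulr_ge0 ?gmean_ge0.
- by move=> e; rewrite mulr_ge0 ?gmean_ge0.
- by rewrite -mulr_sumr sum_a.
- by rewrite -mulr_sumr sum_b.
- by rewrite gammaE.
apply: ge0_ler_powR.
- by rewrite gammaE divr_ge0 ?ltW.
- by rewrite nnegrE sumr_ge0// => e _; rewrite mulr_ge0 ?powR_ge0.
- by rewrite nnegrE scaled_lambda_ge0.
by rewrite -P'E -Q'E scaled_gmean_sum_le.
Qed.

(** Write F and F' for the two scaled values and n for the number of arcs. From F' <= n^(1-t) F^t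
    and n <= F^(1/(1-gamma)), eliminating n bounds F' by a power of F alone. *)
Lemma scaled_lambda_nhomo (a : {u : V | u \in tails G} -> R)
    (b : {v : V | v \in heads G} -> R) : prob_vector a -> prob_vector b ->
  (forall e, e \in arcs G -> (#|arcs G|%:R)^-1 <= k * gmean a e.1) ->
  (forall e, e \in arcs G -> (#|arcs G|%:R)^-1 <= l * gmean b e.2) ->
  scaled_lambda P' Q' `^ (1 / (1 - (r%:R / P' + s%:R / Q'))) <=
  scaled_lambda P Q `^ (1 / (1 - (r%:R / P + s%:R / Q))).
Proof.
move=> pa pb ge_a ge_b; rewrite gamma' alphaE betaE gammaE.
have g1 : 0 < 1 - gamma by rewrite subr_gt0.
have tg1 : 0 < 1 - t * gamma by rewrite subr_gt0 (lt_trans tgamma_lt).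
have t1 : 0 < 1 - t by rewrite subr_gt0.
set n : R := #|arcs G|%:R.
have n0 : 0 < n by rewrite ltr0n card_gt0.
have nV0 : 0 <= n^-1 by rewrite invr_ge0 ltW.
have n_le : n `^ (1 - gamma) <= scaled_lambda P Q.
  apply: (le_trans _ (scaled_gmean_sum_le P_ge1 Q_ge1 pa pb)).
  rewrite alphaE betaE.
  (* Each of the n terms is at least n^(-gamma), so the total is at least n^(1-gamma). *)
  apply: (@le_trans _ _ (\sum_(e in arcs G) n^-1 `^ alpha * n^-1 `^ beta)).
    rewrite sumr_const -mulr_natl -powRD ?invr_eq0 ?(gt_eqF n0) ?implybT//.
    rewrite gammaE -(powR_inv1 (ltW n0)) -powRrM mulN1r.
    by rewrite powRD ?(gt_eqF n0) ?implybT// powRr1// ltW.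
  apply: ler_sum => e eG; apply: ler_pM; rewrite ?powR_ge0//.
    apply: ge0_ler_powR; rewrite ?nnegrE ?mulr_ge0 ?gmean_ge0 ?ge_a//.
    exact: ltW.
  apply: ge0_ler_powR; rewrite ?nnegrE ?mulr_ge0 ?gmean_ge0 ?ge_b//.
  exact: ltW.
have le_hoelder : scaled_lambda P' Q' <= n `^ (1 - t) * scaled_lambda P Q `^ t.
  have := scaled_gmean_sum_le P_ge1 Q_ge1.
  rewrite alphaE betaE => le_F; have [a' [b' [pa' pb' ->]]] := scaled_lambda_gmean P'_ge1 Q'_ge1.
  apply: (@le_trans _ _ (n `^ (1 - t) * (\sum_(e in arcs G)
      (k * gmean a' e.1) `^ alpha * (l * gmean b' e.2) `^ beta) `^ t)); last first.
    rewrite ler_wpM2l ?powR_ge0//; apply: ge0_ler_powR (ltW t_gt0) _ _ _ _ _.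
    - by rewrite nnegrE sumr_ge0// => e _; rewrite mulr_ge0 ?powR_ge0.
    - by rewrite nnegrE scaled_lambda_ge0.
    - exact: le_F.
  by rewrite P'E Q'E mixed_power_sum_le_card// t_gt0.
(* Strict positivity allows powers of F to be multiplied by adding exponents. *)
have F0 : 0 < scaled_lambda P Q.
  by apply: lt_le_trans n_le; exact: powR_gt0.
have le_power : scaled_lambda P' Q' <=
    scaled_lambda P Q `^ ((1 - t * gamma) / (1 - gamma)).
  apply: (le_trans le_hoelder).
  have -> : (1 - t * gamma) / (1 - gamma) = (1 - gamma)^-1 * (1 - t) + t.
    by field; rewrite gt_eqF.
  rewrite [leRHS]powRD; last by rewrite (gt_eqF F0) implybT.
  rewrite ler_wpM2r ?powR_ge0// [leRHS]powRrM; apply: ge0_ler_powR (ltW t1) _ _ _ _ _.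
  - by rewrite nnegrE ltW.
  - by rewrite nnegrE powR_ge0.
  rewrite -[leLHS](_ : (n `^ (1 - gamma)) `^ (1 - gamma)^-1 = n); last first.
    by rewrite -powRrM mulfV ?gt_eqF// powRr1// ltW.
  apply: ge0_ler_powR; rewrite ?nnegrE ?powR_ge0 ?invr_ge0 ?(ltW g1) ?(ltW F0)//.
have -> : 1 / (1 - gamma) =
    (1 - t * gamma) / (1 - gamma) * (1 / (1 - t * gamma)).
  by field; rewrite !gt_eqF.
rewrite [leRHS]powRrM ge0_ler_powR ?nnegrE ?powR_ge0 ?scaled_lambda_ge0//.
by rewrite divr_ge0 ?ler01// ltW.
Qed.

End Monotonicity.

(** * The case without arcs and the final assembly *)

Lemma lambda_arcs0 (R : realType) (V : finType) (r s : nat)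
    (G : dihypergraph V r s) (P Q : R) :
  P != 0 -> arcs G = finset.set0 -> lambda G P Q = 0.
Proof.
move=> P0 G0; rewrite /lambda (_ : lambda_values _ _ _ = classical_sets.set0) ?sup0//.
apply/seteqP; split => // z [x [y [+ _ _]]]; rewrite /lpnorm big1.
  by rewrite powR0 ?invr_eq0// => /eqP; rewrite eq_sym oner_eq0.
by move=> [u uT] _; case/bigcupP: (uT) => e; rewrite G0 inE.
Qed.

Theorem theorem5p5 (R : realType) (V : finType) (r s : nat)
    (G : dihypergraph V r s) (p q : R)
    (r_gt0 : (0 < r)%N) (s_gt0 : (0 < s)%N)
    (p_ge1 : 1 <= p) (q_ge1 : 1 <= q)
    (rpsq_lt1 : r%:R / p + s%:R / q < 1) :
  {in `]r%:R / p + s%:R / q, +oo[ &, {homo fG G p q : x y / x <= y}} /\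
  {in `]r%:R / p + s%:R / q, +oo[ &, {homo gG G p q : x y /~ x <= y}}.
Proof.
have p0 : 0 < p by lra.
have q0 : 0 < q by lra.
have r1 : 1 <= (r%:R : R) by rewrite ler1n.
have s1 : 1 <= (s%:R : R) by rewrite ler1n.
have rp0 : 0 < r%:R / p by rewrite divr_gt0//; lra.
have sq0 : 0 < s%:R / q by rewrite divr_gt0//; lra.
have pos x : r%:R / p + s%:R / q < x -> 0 < x by lra.
(* Since r >= 1, x > r/p >= 1/p; thus the scaled exponents stay in the range where [lambda] is
   attained. *)
have px1 x : r%:R / p + s%:R / q < x -> 1 <= p * x.
  by move=> x_gt; rewrite mulrC -ler_pdivrMr//; apply: (@le_trans _ _ (r%:R / p));
    [rewrite ler_pM2r ?invr_gt0|lra].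
have qx1 x : r%:R / p + s%:R / q < x -> 1 <= q * x.
  by move=> x_gt; rewrite mulrC -ler_pdivrMr//; apply: (@le_trans _ _ (s%:R / q));
    [rewrite ler_pM2r ?invr_gt0|lra].
have sum_lt1 x : r%:R / p + s%:R / q < x -> r%:R / (p * x) + s%:R / (q * x) < 1.
  move=> x_gt; have x0 := pos _ x_gt.
  have -> : r%:R / (p * x) + s%:R / (q * x) = (r%:R / p + s%:R / q) / x.
    by field; rewrite !gt_eqF.
  by rewrite ltr_pdivrMr// mul1r.
have rescale (m c x y : R) : 0 < c -> 0 < x -> 0 < y ->
    m / (c * y) = x / y * (m / (c * x)).
  by move=> c0 x0 y0; field; rewrite !gt_eqF.
(* Without arcs [lambda] is 0 and the outer exponent is positive, so both functions vanish on the
   interval. *)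
have [G0|G0] := eqVneq (arcs G) finset.set0.
  have fg0 (a b x : R) : r%:R / p + s%:R / q < x ->
      (a * b * lambda G (p * x) (q * x))
        `^ (1 / (1 - (r%:R / (p * x) + s%:R / (q * x)))) = 0.
    move=> x_gt; have lt1 := sum_lt1 _ x_gt.
    have px0 : p * x != 0 by rewrite gt_eqF// mulr_gt0// pos.
    rewrite (lambda_arcs0 _ px0 G0) mulr0.
    by rewrite powR0// gt_eqF// divr_gt0// subr_gt0.
  have f0 x : r%:R / p + s%:R / q < x -> fG G p q x = 0 by exact: fg0.
  have g0 x : r%:R / p + s%:R / q < x -> gG G p q x = 0 by exact: fg0.
  split=> x y; rewrite !in_itv/= !andbT => x_gt y_gt _.
    by rewrite !f0.
  by rewrite !g0.
split=> x y; rewrite !in_itv/= !andbT => x_gt y_gt.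
  rewrite le_eqVlt => /predU1P[->//|xy].
  have [x0 y0] := (pos _ x_gt, pos _ y_gt).
  (* Here x < y, so t = x / y; the bounds on sums of geometric means come from the maximum
     degrees. *)
  apply: (@scaled_lambda_homo _ _ _ _ _ r_gt0 s_gt0 G0 _ _ _ _ _ _ _ _ _ _ _ (x / y));
    rewrite ?px1 ?qx1 ?divr_ge0 ?divr_gt0 ?ltr_pdivrMr ?mul1r ?sum_lt1//;
    try exact: rescale.
  - move=> a pa; apply: (@sum_gmean_le _ _ _ (tails G) _ (fun e => e.1)) => //.
    + exact: card_tail.
    + exact: tail_sub.
    + by move=> v vT; exact: leq_bigmax_cond.
  - move=> a pa; apply: (@sum_gmean_le _ _ _ (heads G) _ (fun e => e.2)) => //.
    + exact: card_head.
    + exact: head_sub.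
    + by move=> v vT; exact: leq_bigmax_cond.
rewrite le_eqVlt => /predU1P[->//|yx].
have [x0 y0] := (pos _ x_gt, pos _ y_gt).
(* For g, the degree vectors on T(G) and H(G) serve as the test vectors a and b; now y < x, so t = y
   / x. *)
have [a pa ge_a] := gmean_degree_vector R r_gt0 (@card_tail _ _ _ G)
  (@tail_sub _ _ _ G) G0 (min_outdeg_gt0 G0) (@min_outdeg_le _ _ _ G).
have [b pb ge_b] := gmean_degree_vector R s_gt0 (@card_head _ _ _ G)
  (@head_sub _ _ _ G) G0 (min_indeg_gt0 G0) (@min_indeg_le _ _ _ G).
apply: (@scaled_lambda_nhomo _ _ _ _ _ r_gt0 s_gt0 G0 _ _ _ _ _ _ _ _ _ _ _ (y / x)
    _ _ _ _ _ _ _ _ _ _ _ _ a b);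
  rewrite ?px1 ?qx1 ?divr_ge0 ?divr_gt0 ?ltr_pdivrMr ?mul1r ?sum_lt1//;
  exact: rescale.
Qed.
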